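(* Let $n\geq 5$ and let $\pi=(d_1,d_2,\dots,d_n)$ be a graphic sequence with $d_1\geq d_2\geq\cdots\geq d_n\geq 1$. Then $\pi$ is potentially $(K_5-Y_4)$-graphic if and only if all of the following hold: (1) $d_3\geq 3$; (2) $d_4\geq 2$; (3) $\pi\neq(3^6)$.
   Context: All graphs are finite and simple. A nonincreasing sequence of nonnegative integers is graphic if it is the degree sequence of some simple graph (a realization). A graphic sequence $\pi$ is potentially $H$-graphic if it has a realization containing $H$ as a (not necessarily induced) subgraph. In a sequence, $r^t$ denotes $t$ consecutive terms equal to $r$ (so $(3^6)=(3,3,3,3,3,3)$). $Y_4$ denotes the tree on $5$ vertices with exactly $3$ leaves, and $K_5-Y_4$ is the graph obtained from $K_5$ by deleting the edge set of a copy of $Y_4$ spanning its 5 vertices. *)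

(* Defs.v *)
From mathcomp Require Import all_boot.

Set Implicit Arguments.
Unset Strict Implicit.
Unset Printing Implicit Defensive.

Record sgraph := SGraph {
  vertex :> finType;
  adj : rel vertex;
  adj_sym : symmetric adj;
  adj_irr : irreflexive adj
}.

Definition degree (G : sgraph) (x : G) : nat := #|[set y | adj x y]|.

Definition degree_sequence (G : sgraph) : seq nat :=
  sort geq [seq degree x | x <- enum G].

Definition realization (pi : seq nat) (G : sgraph) : Prop :=
  degree_sequence G = pi.

Definition graphic (pi : seq nat) : Prop := exists G, realization pi G.

(* Not necessarily induced. *)
Definition has_subgraph (G H : sgraph) : Prop :=
  exists2 f : H -> G, injective f & {homo f : x y / adj x y}.

Definition potentially_graphic (H : sgraph) (pi : seq nat) : Prop :=
  exists2 G, realization pi G & has_subgraph G H.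

Definition isomorphic (G H : sgraph) : Prop :=
  exists2 f : G -> H, bijective f & {mono f : x y / adj x y}.

Definition connected (G : sgraph) : Prop :=
  0 < #|G| /\ forall x y : G, connect (@adj G) x y.

(* A [ucycle] of size 2 is just an edge traversed back and forth. *)
Definition acyclic (G : sgraph) : Prop :=
  forall c : seq G, ucycle (@adj G) c -> size c <= 2.

Definition tree (G : sgraph) : Prop := connected G /\ acyclic G.

Definition leaves (G : sgraph) : {set G} := [set x | degree x == 1].

Section Complete.
Variable T : finType.

Definition complete_adj : rel T := fun x y => x != y.

Fact complete_adj_sym : symmetric complete_adj.
Proof. by move=> x y; rewrite /complete_adj eq_sym. Qed.

Fact complete_adj_irr : irreflexive complete_adj.
Proof. by move=> x; rewrite /complete_adj eqxx. Qed.

Definition complete : sgraph := SGraph complete_adj_sym complete_adj_irr.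

End Complete.

Section DeleteEdges.
Variables (G : sgraph) (e : rel G).
Hypothesis e_sym : symmetric e.

Definition delete_adj : rel G := fun x y => adj x y && ~~ e x y.

Fact delete_adj_sym : symmetric delete_adj.
Proof. by move=> x y; rewrite /delete_adj adj_sym e_sym. Qed.

Fact delete_adj_irr : irreflexive delete_adj.
Proof. by move=> x; rewrite /delete_adj adj_irr. Qed.

Definition delete_edges : sgraph := SGraph delete_adj_sym delete_adj_irr.

End DeleteEdges.

Definition Y4_edges : seq (nat * nat) := [:: (0, 1); (0, 2); (0, 3); (3, 4)].

Definition Y4_adj_nat : rel nat :=
  fun i j => ((i, j) \in Y4_edges) || ((j, i) \in Y4_edges).

Definition Y4_adj : rel 'I_5 := fun i j => Y4_adj_nat i j.

Fact Y4_adj_sym : symmetric Y4_adj.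
Proof. by move=> i j; rewrite /Y4_adj /Y4_adj_nat orbC. Qed.

Fact Y4_adj_irr : irreflexive Y4_adj.
Proof. by move=> [[|[|[|[|[|i]]]]] Hi]. Qed.

Definition Y4 : sgraph := SGraph Y4_adj_sym Y4_adj_irr.

Definition K5_minus_Y4 : sgraph :=
  @delete_edges (complete 'I_5) (@adj Y4) (@adj_sym Y4).

(* The next lemmas justify calling [Y4] "the tree on 5 vertices with exactly
   3 leaves". *)

Lemma card_Y4 : #|Y4| = 5.
Proof. exact: card_ord. Qed.

Lemma degree_Y4 (x : Y4) : degree x = nth 0 [:: 3; 1; 1; 2; 1] (x : 'I_5).
Proof.
rewrite /degree -sum1dep_card big_mkcond !big_ord_recl big_ord0.
by case: x => [[|[|[|[|[|i]]]]] Hi].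
Qed.

Lemma card_leaves_Y4 : #|leaves Y4| = 3.
Proof.
rewrite /leaves -sum1dep_card big_mkcond.
under eq_bigr do rewrite degree_Y4.
by rewrite !big_ord_recl big_ord0.
Qed.

Lemma connected_Y4 : connected Y4.
Proof.
split=> [|x y]; first by rewrite card_Y4.
pose o : Y4 := @Ordinal 5 0 isT; pose t : Y4 := @Ordinal 5 3 isT.
suff Co z : connect (@adj Y4) o z.
  apply: connect_trans (Co y).
  by rewrite (sym_connect_sym (@adj_sym Y4)).
have ot : connect (@adj Y4) o t by apply: connect1.
case: z => [[|[|[|[|[|i]]]]] Hi] //.
- by rewrite (_ : Ordinal Hi = o) ?connect0 //; apply: val_inj.
- exact: connect1.
- exact: connect1.
- exact: connect1.
- by apply: connect_trans ot _; apply: connect1.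
Qed.

Fixpoint words (k : nat) : seq (seq nat) :=
  if k is k'.+1 then [seq i :: w | i <- iota 0 5, w <- words k'] else [:: [::]].

Lemma wordsP (c : seq 'I_5) : map val c \in words (size c).
Proof.
elim: c => [|i c IHc] //=.
have Hi : val i \in iota 0 5 by rewrite mem_iota /=.
exact: (allpairs_f cons Hi IHc).
Qed.

Lemma acyclic_Y4 : acyclic Y4.
Proof.
move=> c /andP[cyc_c uniq_c].
pose ok w := ~~ (cycle Y4_adj_nat w && uniq w).
have okP k : 2 < k < 6 -> all ok (words k).
  by case: k => [|[|[|[|[|[|k]]]]]] // _; vm_compute.
have sz_c : size c <= 5 by rewrite -card_Y4 -(card_uniqP uniq_c) max_card.
rewrite leqNgt; apply/negP=> lt2c.
have /allP/(_ _ (wordsP c)) := okP (size c) (introT andP (conj lt2c sz_c)).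
by rewrite /ok (map_inj_uniq val_inj) uniq_c andbT cycle_map cyc_c.
Qed.

Lemma tree_Y4 : tree Y4.
Proof. by split; [apply: connected_Y4 | apply: acyclic_Y4]. Qed.

Lemma leaf_nbr (G : sgraph) (x : G) :
  x \in leaves G -> exists y, forall z, adj x z = (z == y).
Proof.
rewrite inE => /cards1P[y Ny]; exists y => z.
by have /setP/(_ z) := Ny; rewrite !inE.
Qed.

Lemma closed_connected (G : sgraph) (A : {set G}) x y :
  connected G -> x \in A ->
  (forall a b, a \in A -> adj a b -> b \in A) -> y \in A.
Proof.
move=> [_ /(_ x y) Cxy] Ax clA; have clA' : closed (@adj G) A.
  apply: intro_closed; first exact: sym_connect_sym (@adj_sym G).
  by move=> a b ab Aa; apply: clA ab.
by rewrite -(closed_connect clA' Cxy).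
Qed.

Lemma Y4_unique (T : sgraph) :
  tree T -> #|T| = 5 -> #|leaves T| = 3 -> isomorphic Y4 T.
Proof.
move=> [conT _] cardT cardL.
have /cards2P[u [v [nuv defN]]] : #|~: leaves T| == 2.
  by rewrite -(eqn_add2l #|leaves T|) cardsC cardT cardL.
have inL x : (x \in leaves T) = (x != u) && (x != v).
  have /setP/(_ x) := defN; rewrite in_setC !in_set2.
  by case: (x \in leaves T); case: (x == u); case: (x == v).
have Lu : u \notin leaves T by rewrite inL eqxx.
have Lv : v \notin leaves T by rewrite inL eqxx andbF.
have nbr x : x \in leaves T -> adj x =1 pred1 u \/ adj x =1 pred1 v.
  move=> Lx; have [y Ny] := leaf_nbr Lx.
  have [Ly|] := boolP (y \in leaves T); last first.
    rewrite inL negb_and !negbK => /orP[] /eqP yE; [left|right] => z /=;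
    by rewrite Ny yE.
  have [x' Ny'] := leaf_nbr Ly.
  have x'E : x' = x by apply/esym/eqP; rewrite -Ny' adj_sym Ny.
  have : u \in [set x; y].
    apply: (closed_connected _ conT (set21 x y)) => a b.
    rewrite !inE => /orP[] /eqP->; rewrite ?Ny ?Ny' => /eqP->;
    by rewrite ?x'E eqxx ?orbT.
  by rewrite !inE => /orP[] /eqP uE; case/negP: Lu; rewrite uE.
have uv : adj u v.
  apply: contraT => nuvA.
  have : v \in u |: [set x in leaves T | adj x u].
    apply: (closed_connected _ conT (setU11 _ _)) => a b.
    rewrite !inE => /orP[/eqP->|/andP[La au]] ab.
      have [->|nbu] := eqVneq b u; first by [].
      have nbv : b != v by apply: contraNneq nuvA => <-.
      by have := inL b; rewrite nbu nbv inE adj_sym ab => ->.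
    have La' : a \in leaves T by rewrite inE.
    case: (nbr a La') => Na; move: au ab; rewrite !Na /= => au ab; first by rewrite ab.
    by rewrite (negPf nuv) in au.
  by rewrite !inE eq_sym (negPf nuv) /= => /andP[Dv _]; case/negP: Lv; rewrite inE.
(* A non-leaf [a] adjacent to the other non-leaf [b] has a leaf neighbour. *)
have other a b : a \notin leaves T -> adj a b ->
    (forall x, (x \in leaves T) = (x != a) && (x != b)) ->
    exists2 x, x \in leaves T & adj a x.
  move=> La ab inL'; apply/exists_inP; apply: contraT => /exists_inPn noL.
  case/negP: La; rewrite inE; apply/cards1P; exists b; apply/setP=> z.
  rewrite !inE; apply/idP/eqP=> [az|->//].
  apply/eqP; apply: contraTT az => nzb.
  have [->|nza] := eqVneq z a; first by rewrite adj_irr.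
  by apply: noL; rewrite inL' nza nzb.
have inL' x : (x \in leaves T) = (x != v) && (x != u) by rewrite inL andbC.
have vu : adj v u by rewrite adj_sym.
have [x Lx ux] := other u v Lu uv inL.
have [y Ly vy] := other v u Lv vu inL'.
have lu a : a \in leaves T -> adj u a -> adj a =1 pred1 u.
  move=> La; rewrite adj_sym; case: (nbr a La) => // Na.
  by rewrite Na /= (negPf nuv).
have lv a : a \in leaves T -> adj v a -> adj a =1 pred1 v.
  move=> La; rewrite adj_sym; case: (nbr a La) => // Na.
  by rewrite Na /= eq_sym (negPf nuv).
have nxy : x != y.
  apply: contraTneq vy => <-; rewrite adj_sym (lu x Lx ux) /=.
  by rewrite eq_sym.
have /cards1P[z defz] : #|leaves T :\ x :\ y| == 1.
  move/eqP: cardL; rewrite (cardsD1 x) Lx (cardsD1 y (leaves T :\ x)).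
  by rewrite in_setD1 Ly (eq_sym y) nxy.
have : z \in leaves T :\ x :\ y by rewrite defz set11.
rewrite !in_setD1 => /and3P[nzy nzx Lz].
(* [c] has the three neighbours [p], [q], [d], and [d] has the leaf [r]. *)
have build (c d p q r : T) : uniq [:: c; p; q; d; r] -> adj c d ->
    adj p =1 pred1 c -> adj q =1 pred1 c -> adj r =1 pred1 d -> isomorphic Y4 T.
  move=> Us cd Np Nq Nr; pose s := [:: c; p; q; d; r].
  have inj_f : injective (fun i : 'I_5 => nth c s i).
    move=> i j /eqP; rewrite nth_uniq ?ltn_ord // => /eqP; exact: val_inj.
  exists (fun i : 'I_5 => nth c s i).
    by apply: inj_card_bij inj_f _; rewrite cardT card_ord.
  have dc : adj d c by rewrite adj_sym.
  have Np' w : adj w p = (w == c) by rewrite adj_sym Np.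
  have Nq' w : adj w q = (w == c) by rewrite adj_sym Nq.
  have Nr' w : adj w r = (w == d) by rewrite adj_sym Nr.
  move: Us; rewrite /= !inE !negb_or.
  move=> /and5P[/and4P[cp cq nd cr] /and3P[pq pd pr] /andP[qd qr] dr _].
  have neqs := (negPf cp, negPf cq, negPf nd, negPf cr, negPf pq, negPf pd,
                negPf pr, negPf qd, negPf qr, negPf dr).
  have neqs' := (eq_sym p c, eq_sym q c, eq_sym d c, eq_sym r c, eq_sym q p,
                 eq_sym d p, eq_sym r p, eq_sym d q, eq_sym r q, eq_sym r d).
  by case=> [[|[|[|[|[|i]]]]] Hi] //; case=> [[|[|[|[|[|j]]]]] Hj] //;
    rewrite /= ?adj_irr ?cd ?dc ?Np ?Nq ?Nr ?Np' ?Nq' ?Nr' /= ?eqxx ?neqs //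
      ?neqs' ?neqs.
have [nxu nxv] : x != u /\ x != v by move: Lx; rewrite inL => /andP.
have [nyu nyv] : y != u /\ y != v by move: Ly; rewrite inL => /andP.
have [nzu nzv] : z != u /\ z != v by move: Lz; rewrite inL => /andP.
case: (nbr z Lz) => Nz.
  apply: (build u v x z y) (lu x Lx ux) Nz (lv y Ly vy) => //.
  rewrite /= !inE !negb_or nuv nxv nzv nxy nzy (eq_sym u x) nxu (eq_sym u z) nzu.
  by rewrite (eq_sym u y) nyu (eq_sym x z) nzx (eq_sym v y) nyv.
apply: (build v u y z x) (lv y Ly vy) Nz (lu x Lx ux) => //.
rewrite /= !inE !negb_or (eq_sym v u) nuv nyu nzu nzx (eq_sym v y) nyv.
rewrite (eq_sym v z) nzv (eq_sym v x) nxv (eq_sym y z) nzy (eq_sym y x) nxy.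
by rewrite (eq_sym u x) nxu.
Qed.

(* Main.v *)
(* K5 - Y4 is the kite: a diamond (K4 minus an edge) with a pendant edge at one
   of the two vertices of degree 2 of the diamond.

   Degrees are preserved by a switch, which replaces two edges ab, cd by two
   nonedges ac, bd.  If a realization contains a diamond but no kite, then the
   ends of the diamond have no further neighbours, and a few switches with an
   edge elsewhere, or with a third vertex of degree at least 3, produce a kite.
   Similarly a prism either is the whole graph, which is the excluded case
   (3^6), or leads to a diamond.  It remains to find a diamond or a prism.  By
   Havel-Hakimi the vertex v1 of largest degree may be taken adjacent to the
   next three v2, v3, v4, and two edges among these make a diamond.  If there
   are fewer, switch neighbours of v2, v3, v4 away to gain an edge; when this is
   obstructed, the neighbours are adjacent to each other, and this provides a
   diamond or a prism. *)

Require Import Defs.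
From mathcomp Require Import all_boot.

Set Implicit Arguments.
Unset Strict Implicit.
Unset Printing Implicit Defensive.

Lemma exists_notin (T : finType) (A : {set T}) (s : seq T) :
  size s < #|A| -> exists2 x, x \in A & x \notin s.
Proof.
move=> ltsA; apply/exists_inP; rewrite -[[exists _ in _, _]]negbK.
apply: contraL ltsA; rewrite negb_exists_in -leqNgt => /forall_inP As.
apply: leq_trans (card_size s); apply/subset_leq_card/subsetP=> x /As.
by rewrite negbK.
Qed.

(** * Switches on a fixed vertex set *)

Section Switch.
Variables (V : finType) (dg : V -> nat).
Implicit Types (e : rel V) (a b c d p q r s t u v w x y z : V).

(** The degree of each single vertex is prescribed, not just the sorted sequence, so degree
    hypotheses about named vertices survive every switch. *)
Record realizes e : Prop := Realizes {
  realizes_sym : symmetric e;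
  realizes_irr : irreflexive e;
  realizes_deg x : #|[set y | e x y]| = dg x
}.

Definition pair_rel a b : rel V :=
  fun x y => (x == a) && (y == b) || (x == b) && (y == a).

Definition switch e a b c d : rel V := fun x y =>
  [|| e x y && ~~ pair_rel a b x y && ~~ pair_rel c d x y,
      pair_rel a c x y | pair_rel b d x y].

Lemma pair_rel_sym a b : symmetric (pair_rel a b).
Proof.
by move=> x y; rewrite /pair_rel orbC (andbC (y == b)) (andbC (y == a)).
Qed.

Lemma pair_relC a b : pair_rel b a =2 pair_rel a b.
Proof. by move=> x y; rewrite /pair_rel orbC. Qed.

Lemma switchC e a b c d : switch e c d a b =2 switch e a b c d.
Proof.
by move=> x y; rewrite /switch (pair_relC a c) (pair_relC b d) -!andbA
  (andbC (~~ pair_rel c d x y)).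
Qed.

Lemma switch_rev e a b c d : switch e b a d c =2 switch e a b c d.
Proof.
by move=> x y; rewrite /switch (pair_relC a b) (pair_relC c d)
  (orbC (pair_rel b d x y)).
Qed.

(** At [a], the neighbour [c] takes the place of [b]. The other three ends of the switched edges
    reduce to this case through [switch_rev] and [switchC]. *)
Lemma card_switch e a b c d : symmetric e -> irreflexive e ->
    e a b -> e c d -> ~~ e a c -> a != c ->
  #|[set y | switch e a b c d a y]| = #|[set y | e a y]|.
Proof.
move=> sym irr ab cd ac nac.
have nab : a != b by apply: contraTneq ab => ->; rewrite irr.
have nad : a != d by apply: contraTneq cd => <-; rewrite sym.
have -> : [set y | switch e a b c d a y] = c |: ([set y | e a y] :\ b).
  apply/setP=> y; rewrite !inE /switch /pair_rel !eqxx.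
  rewrite (negPf nab) (negPf nac) (negPf nad) /= !orbF !andbT.
  by rewrite orbC andbC.
rewrite cardsU1 !inE (negPf ac) andbF.
by rewrite [RHS](cardsD1 b) inE ab.
Qed.

Lemma realizes_switch e a b c d : realizes e ->
    e a b -> e c d -> ~~ e a c -> ~~ e b d -> a != c -> b != d ->
  realizes (switch e a b c d).
Proof.
case=> sym irr deg ab cd ac bd nac nbd; split.
- by move=> x y; rewrite /switch sym !(pair_rel_sym _ _ x).
- move=> x; rewrite /switch irr /pair_rel /=.
  rewrite (andbC (x == c)) (andbC (x == d)) !orbb; apply/norP.
  by split; apply/negP=> /andP[/eqP-> /eqP E]; [case/eqP: nac|case/eqP: nbd].
move=> x; rewrite -deg.
have [ba dc] : e b a /\ e d c by rewrite ![e _ a]sym ![e _ c]sym.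
have [ca db] : ~~ e c a /\ ~~ e d b by rewrite ![e _ a]sym ![e _ b]sym.
have [->|nxa] := eqVneq x a; first exact: card_switch.
have [->|nxb] := eqVneq x b.
  rewrite -(card_switch sym irr ba dc) //.
  by apply: eq_card => y; rewrite !inE switch_rev.
have [->|nxc] := eqVneq x c.
  rewrite -(card_switch sym irr cd ab) // 1?eq_sym //.
  by apply: eq_card => y; rewrite !inE switchC.
have [->|nxd] := eqVneq x d.
  rewrite -(card_switch sym irr dc ba) // 1?eq_sym //.
  by apply: eq_card => y; rewrite !inE switch_rev switchC.
apply: eq_card => y; rewrite !inE /switch /pair_rel.
by rewrite (negPf nxa) (negPf nxb) (negPf nxc) (negPf nxd) /= !andbT orbF.
Qed.

Lemma nbr_notin e x (s : seq V) : realizes e -> size s < dg x ->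
  exists2 y, e x y & y \notin s.
Proof.
move=> Re; rewrite -(realizes_deg Re) => /exists_notin[y].
by rewrite inE; exists y.
Qed.

(* The diamond has centres [p], [q] and ends [r], [s]. *)
Definition kite e p q r s t :=
  [&& e p q, e p r, e q r, e p s, e q s, e r t, r != s & t \notin [:: p; q; s]].

Definition diamond e p q r s := [&& e p q, e p r, e q r, e p s, e q s & r != s].

Definition prism e a b c a' b' c' :=
  [&& [&& e a b, e b c & e a c], [&& e a' b', e b' c' & e a' c'],
      [&& e a a', e b b' & e c c'] & uniq [:: a; b; c; a'; b'; c']].

Definition kitable := exists e p q r s t, realizes e /\ kite e p q r s t.

Lemma adj_neq e x y : irreflexive e -> e x y -> x != y.
Proof. by move=> irr; apply: contraTneq => ->; rewrite irr. Qed.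

Lemma sep_neq e x y z : e x z -> ~~ e y z -> x != y.
Proof. by move=> xz; apply: contraNneq => <-. Qed.

(** * Deciding adjacency and distinctness of named vertices *)

Ltac edge :=
  match goal with
  | H : is_true (?e ?x ?y) |- is_true (?e ?x ?y) => exact H
  | H : is_true (?e ?x ?y), S : symmetric ?e |- is_true (?e ?y ?x) =>
      rewrite S; exact H
  end.

Ltac nonedge :=
  match goal with
  | H : is_true (~~ ?e ?x ?y) |- is_true (~~ ?e ?x ?y) => exact H
  | H : is_true (~~ ?e ?x ?y), S : symmetric ?e |- is_true (~~ ?e ?y ?x) =>
      rewrite S; exact H
  | I : irreflexive ?e |- is_true (~~ ?e ?x ?x) => rewrite I; exact isT
  end.

(* Two vertices are distinct when they are adjacent, or when some vertex is a
   neighbour of exactly one of them. *)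
Ltac separate e x y :=
  match goal with
  | H : is_true (e x ?z) |- _ => apply: (@sep_neq e x y z H); nonedge
  | H : is_true (e ?z x), S : symmetric e |- _ =>
      apply: (@sep_neq e x y z); [rewrite S; exact H | nonedge]
  end.

Ltac neq :=
  first
  [ assumption | rewrite eq_sym; assumption
  | match goal with
    | I : irreflexive ?e |- is_true (?x != ?y) =>
      first [ apply: (adj_neq I); edge | separate e x y
            | rewrite eq_sym; separate e y x ]
    end ].

Ltac eval_eq :=
  repeat match goal with
  | |- context [?x == ?x] => rewrite (eqxx x)
  | |- context [?x == ?y] =>
      let H := fresh in
      (have H : x != y by neq); rewrite (negPf H); clear H
  end.

Ltac eval_adj :=
  repeat match goal with
  | H : is_true (?e ?x ?y) |- context [?e ?x ?y] => rewrite H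
  | H : is_true (?e ?x ?y), S : symmetric ?e |- context [?e ?y ?x] =>
      rewrite (S y x) H
  | H : is_true (~~ ?e ?x ?y) |- context [?e ?x ?y] => rewrite (negPf H)
  | H : is_true (~~ ?e ?x ?y), S : symmetric ?e |- context [?e ?y ?x] =>
      rewrite (S y x) (negPf H)
  end.

Ltac split_and :=
  repeat match goal with H : is_true (_ && _) |- _ => case/andP: H => ? ? end.

(** Adjacency after a switch unfolds to equalities of vertices and adjacency before it, which the
    hypotheses decide. A case below then only has to name the switch and the configuration that
    results. *)
Ltac graph :=
  rewrite /diamond /kite /prism /switch /pair_rel /= ?inE ?negb_or;
  eval_eq; eval_adj; rewrite ?andbT ?andbF ?orbT ?orbF //=.

Ltac do_switch a b c d :=
  apply: (@realizes_switch _ a b c d); [ try assumption | graph .. ].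

(** * Joining a vertex to the vertices of largest degree *)

(** Some neighbour [w] of [v] lies outside [s]. If [x] has a neighbour [z] that [w] lacks, switching
    the edges [v w] and [x z] trades [w] for [x] at [v] and leaves the neighbours in [s] alone. *)
Lemma realizes_attach e v x (s : seq V) : realizes e ->
    size s < dg v -> x != v -> (forall y, y \in s -> e v y) ->
    (forall w, w \notin s -> w != v -> dg w <= dg x) ->
  exists2 e', realizes e' & forall y, y \in x :: s -> e' v y.
Proof.
move=> Re ltsv nxv sv maxx; have [sym irr deg] := Re.
have [vx|vx] := boolP (e v x).
  by exists e => // y; rewrite inE => /predU1P[->|/sv].
have [w vw ws] := @nbr_notin e v s Re ltsv.
have nwv : w != v by neq.
have nwx : w != x by neq.
(* Otherwise [w], which has the neighbour [v] that [x] lacks, would have larger degree than [x]. *)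
have [z xz /andP[nzw zw]] : exists2 z, e x z & (z != w) && ~~ e z w.
  apply/exists_inP; apply: contraLR (maxx w ws nwv); rewrite -ltnNge.
  rewrite negb_exists_in => /forall_inP Nx.
  have xw : #|[set z | e x z] :\ w| <= #|[set z | e w z] :\ x :\ v|.
    apply/subset_leq_card/subsetP=> z; rewrite !inE => /andP[nzw xz].
    have := Nx z xz; rewrite nzw negbK sym => ->.
    have -> : z != v by apply: contraNneq vx => <-; rewrite sym.
    by have -> : z != x by apply: contraTneq xz => ->; rewrite irr.
  rewrite -!deg (cardsD1 w [set z | e x z]) (cardsD1 x [set z | e w z]).
  rewrite (cardsD1 v ([set z | e w z] :\ x)) !inE (sym w v) vw (sym w x).
  by rewrite (eq_sym v) nxv ltn_add2l add1n ltnS.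
exists (switch e v w x z); first by do_switch v w x z.
move=> y; rewrite inE => /predU1P[->|ys]; first by graph.
have nyw : y != w by apply: contraNneq ws => <-.
have vy := sv y ys.
by graph.
Qed.

(* Havel-Hakimi. *)
Lemma realizes_star e v (s t : seq V) : realizes e -> uniq (v :: s ++ t) ->
    (forall x, x \in v :: s ++ t) -> sorted (relpre dg geq) (s ++ t) ->
    size s <= dg v ->
  exists2 e', realizes e' & {in s, forall y, e' v y}.
Proof.
elim/last_ind: s t => [|s x IHs] t Re; first by exists e.
rewrite cat_rcons size_rcons => Uv in_v s_sorted lts.
(* The last prescribed neighbour [x] becomes the head of the remaining list, so by sortedness no
   vertex outside [s], except perhaps [v], has larger degree. *)
have [e1 Re1 adj1] := IHs (x :: t) Re Uv in_v s_sorted (ltnW lts).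
have nxv : x != v.
  case/andP: Uv => v_notin _; apply: contraNneq v_notin => <-.
  by rewrite mem_cat mem_head orbT.
have maxx w : w \notin s -> w != v -> dg w <= dg x.
  move=> ws wv; have := in_v w.
  rewrite inE (negPf wv) mem_cat (negPf ws) inE => /predU1P[->//|wt].
  have geq_trans : transitive (relpre dg geq).
    by move=> a b c ba ac; apply: leq_trans ac ba.
  have [_ pth] := cat_sorted2 s_sorted.
  exact: (allP (order_path_min geq_trans pth) w wt).
have [e2 Re2 adj2] := realizes_attach Re1 lts nxv adj1 maxx.
by exists e2 => // y; rewrite mem_rcons; apply: adj2.
Qed.

(** * From a diamond to a kite *)

Section Potential.
Hypothesis V_ge5 : 4 < #|V|.
Hypothesis dg_gt0 : forall x, 0 < dg x.
Hypothesis three_big : 2 < #|[set x | 2 < dg x]|.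
Hypothesis not_cubic6 : ~ (#|V| = 6 /\ forall x, dg x = 3).

Lemma kite_kitable e p q r s t : realizes e -> kite e p q r s t -> kitable.
Proof. by move=> Re K; exists e, p, q, r, s, t. Qed.

(** Each vertex of a complete graph on four vertices is an end of a diamond in it, so an edge
    leaving it serves as pendant. Without such an edge, a fifth vertex [u] has an edge [u w]
    elsewhere, and switching it with [r s] makes [r u] the pendant. *)
Lemma K4_kitable e p q r s : realizes e ->
  diamond e p q r s -> e r s -> kitable.
Proof.
move=> Re /and5P[pq pr qr ps /andP[qs nrs]] rs.
have [sym irr deg] := Re.
have out x u : x \in [:: p; q; r; s] -> e x u -> u \notin [:: p; q; r; s] ->
    kitable.
  rewrite !inE !negb_or => xS xu /and4P[up uq ur us].
  by case/or4P: xS => /eqP E; move: xu; rewrite E => xu;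
    [apply: (@kite_kitable e q r p s u)|apply: (@kite_kitable e p r q s u)
    |apply: (@kite_kitable e p q r s u)|apply: (@kite_kitable e p q s r u)] 
    => //; graph.
have [u _ uS] : exists2 u, u \in [set: V] & u \notin [:: p; q; r; s].
  by apply: exists_notin; rewrite cardsT.
have [w uw _] := @nbr_notin e u [::] Re (dg_gt0 u).
have [wS|wS] := boolP (w \in [:: p; q; r; s]).
  by apply: (out w u wS _ uS); edge.
have [ru|ru] := boolP (e r u).
  by apply: (out r u _ ru uS); rewrite !inE eqxx !orbT.
have [sw|sw] := boolP (e s w).
  by apply: (out s w _ sw wS); rewrite !inE eqxx !orbT.
move: uS wS; rewrite !inE !negb_or => /and4P[up uq ur us] /and4P[wp wq wr ws].
have Re' : realizes (switch e r s u w) by do_switch r s u w.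
by apply: (kite_kitable Re' (p := p) (q := q) (r := r) (s := s) (t := u));
  graph.
Qed.

(* The triangle [pqt] replaces [pqr]: [t] takes [q] over from [r]. *)
Lemma fork_kitable e p q r s t u w : realizes e ->
    [&& e p q, e q r, e p s, e q s & e p t] -> ~~ e q t ->
    [&& e t u, e t w & u != w] -> ~~ e r u ->
    [&& r != s, r != t, s != t, r != u, u != p, u != q & u != s] ->
    [&& w != p, w != q, w != s, q != t & p != r] ->
  kitable.
Proof.
move=> Re /and5P[pq qr ps qs pt] qt /and3P[tu tw uw] ru.
move=> /and4P[rs rt st /and4P[nru up uq us]] /and5P[wp wq ws nqt pr].
have [sym irr _] := Re.
(* [t] loses [u] in the switch and keeps [w] as the pendant vertex. *)
have Re' : realizes (switch e q r t u) by do_switch q r t u.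
by apply: (kite_kitable Re' (p := p) (q := q) (r := t) (s := s) (t := w));
  graph.
Qed.

Lemma diamond_kitable e p q r s : realizes e -> diamond e p q r s -> kitable.
Proof.
move=> Re D; have [rs|rs] := boolP (e r s); first exact: K4_kitable Re D rs.
have /and5P[pq pr qr ps /andP[qs nrs]] := D.
have [sym irr deg] := Re.
have [/existsP[u /and3P[ru up uq]]|/existsPn Nr] :=
    boolP [exists u, [&& e r u, u != p & u != q]].
  by apply: (@kite_kitable e p q r s u) => //; graph.
have [/existsP[u /and3P[su up uq]]|/existsPn Ns] :=
    boolP [exists u, [&& e s u, u != p & u != q]].
  by apply: (@kite_kitable e p q s r u) => //; graph.
have small x : (forall u, ~~ [&& e x u, u != p & u != q]) -> dg x <= 2.
  move=> Nx; rewrite leqNgt; apply/negP=> ltx.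
  have [y xy] := @nbr_notin e x [:: p; q] Re ltx.
  by rewrite !inE negb_or => /andP[yp yq]; have := Nx y; rewrite xy yp yq.
(* Apart from the centres there is still a vertex of degree at least 3, and by [small] it is not an
   end. *)
have [t] := @exists_notin _ [set x | 2 < dg x] [:: p; q] three_big.
rewrite !inE negb_or => dt /andP[tp tq].
have tr : t != r by apply: contraTneq dt => ->; rewrite -leqNgt small.
have ts : t != s by apply: contraTneq dt => ->; rewrite -leqNgt small.
have Nout x y : (forall u, ~~ [&& e x u, u != p & u != q]) ->
    y != p -> y != q -> ~~ e x y.
  by move=> Nx yp yq; have := Nx y; rewrite yp yq !andbT.
have rt := Nout r t Nr tp tq; have st := Nout s t Ns tp tq.
have tnbr y z : exists u, [/\ e t u, u != y & u != z].
  have [u tu] := @nbr_notin e t [:: y; z] Re dt.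
  by rewrite !inE negb_or => /andP[uy uz]; exists u.
(* If [t] is adjacent to both centres, it replaces an end and a third neighbour is the pendant; with
   exactly one centre, [fork_kitable] applies. *)
have [tpA|tpA] := boolP (e t p); have [tqA|tqA] := boolP (e t q).
- have [u [tu up uq]] := tnbr p q.
  by apply: (@kite_kitable e p q t r u) => //; graph.
- have [u [tu up _]] := tnbr p p; have [w [tw wp wu]] := tnbr p u.
  have uq : u != q by neq.
  have ru := Nout r u Nr up uq.
  by apply: (@fork_kitable e p q r s t u w) => //; graph.
- have [u [tu uq _]] := tnbr q q; have [w [tw wq wu]] := tnbr q u.
  have up : u != p by neq.
  have ru := Nout r u Nr up uq.
  by apply: (@fork_kitable e q p r s t u w) => //; graph.
(* With neither centre adjacent, a switch first joins [t] to [p] at the cost of [u]; the neighbours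
   [w] and [v] remain for [fork_kitable]. *)
have [u [tu _ _]] := tnbr t t; have [w [tw wu _]] := tnbr u u.
have [v [tv vu vw]] := tnbr u w.
have Re' : realizes (switch e p r t u).
  have ru : ~~ e r u by apply: (Nout r u Nr); neq.
  by do_switch p r t u.
have rw : ~~ e r w by apply: (Nout r w Nr); neq.
have su : ~~ e s u by apply: (Nout s u Ns); neq.
have sw : ~~ e s w by apply: (Nout s w Ns); neq.
have sv : ~~ e s v by apply: (Nout s v Ns); neq.
by apply: (fork_kitable Re' (p := p) (q := q) (r := r) (s := s) (t := t)
  (u := w) (w := v)); graph.
Qed.

(** * Prisms *)

(** The symmetries of a prism act transitively on its vertices, so what holds for [a] transfers to
    the other five. *)
Lemma prism_relabel e a b c a' b' c' x : symmetric e ->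
    prism e a b c a' b' c' -> x \in [:: a; b; c; a'; b'; c'] ->
  exists p q p' q' r', prism e x p q p' q' r' /\
    [:: x; p; q; p'; q'; r'] =i [:: a; b; c; a'; b'; c'].
Proof.
rewrite /prism /= !inE !negb_or => sym P xS; split_and.
case/or4P: xS => [/eqP->|/eqP->|/eqP->|/or3P[]/eqP->];
  [exists b, c, a', b', c'|exists c, a, b', c', a'|exists a, b, c', a', b'
  |exists b', c', a, b, c|exists c', a', b, c, a|exists a', b', c, a, b];
  (split; [by graph|by move=> y; rewrite !inE; do 6!case: (y == _)]).
Qed.

(** An edge from [a] to [b'] or [c'] closes a diamond, and switching [a w] with the edge [b' c']
    supplies one. Both ways of switching are blocked only if [w] is adjacent to [b'] and [c'], and
    then [b' c'] lies in two triangles. *)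
Lemma prism_nbr_kitable e a b c a' b' c' w : realizes e ->
    prism e a b c a' b' c' -> e a w -> w \notin [:: b; c; a'] ->
  kitable.
Proof.
rewrite /prism /= !inE !negb_or => Re P aw wN; split_and.
have [sym irr _] := Re.
have [ab'|ab'] := boolP (e a b').
  by apply: (diamond_kitable Re (p := a) (q := b) (r := c) (s := b')); graph.
have [ac'|ac'] := boolP (e a c').
  by apply: (diamond_kitable Re (p := a) (q := c) (r := b) (s := c')); graph.
have [wc'|wc'] := boolP (e w c'); last first.
  have Re' : realizes (switch e a w b' c') by do_switch a w b' c'.
  by apply: (diamond_kitable Re' (p := a) (q := b) (r := c) (s := b')); graph.
have [wb'|wb'] := boolP (e w b'); last first.
  have Re' : realizes (switch e a w c' b') by do_switch a w c' b'.
  by apply: (diamond_kitable Re' (p := a) (q := c) (r := b) (s := c')); graph.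
by apply: (diamond_kitable Re (p := b') (q := c') (r := a') (s := w)); graph.
Qed.

(** By [prism_nbr_kitable] the prism may be taken to be a cubic component. As the whole graph it is
    excluded by [not_cubic6]; otherwise an edge outside it is available for switching. *)
Lemma prism_kitable e a b c a' b' c' : realizes e ->
  prism e a b c a' b' c' -> kitable.
Proof.
move=> Re P; have [sym irr deg] := Re; pose S := [:: a; b; c; a'; b'; c'].
have step x : x \in S -> kitable \/ dg x = 3 /\ forall y, e x y -> y \in S.
  case/(prism_relabel sym P)=> p [q [p' [q' [r' [P' defS]]]]].
  have [/existsP[w /andP[xw wN]]|/existsPn noN] :=
    boolP [exists w, e x w && (w \notin [:: p; q; p'])].
    by left; apply: prism_nbr_kitable Re P' xw wN.
  have inN w : e x w -> w \in [:: p; q; p'].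
    by move=> xw; have := noN w; rewrite xw negbK.
  right; split=> [|y /inN yN]; last by rewrite -defS !inE in yN *; case/or3P:
    yN => ->; rewrite ?orbT.
  move: P'; rewrite /prism /= !inE !negb_or => P'; split_and.
  have Un : uniq [:: p; q; p'] by rewrite /= !inE; graph.
  rewrite -deg -[3]/(size [:: p; q; p']) -(card_uniqP Un).
  apply: eq_card => y; rewrite inE; apply/idP/idP => [/inN //|].
  by rewrite !inE => /or3P[]/eqP->; edge.
have [/existsP[u uS]|/existsPn allS] := boolP [exists u, u \notin S].
  have [w uw _] := @nbr_notin e u [::] Re (dg_gt0 u).
  have adjS x y : x \in S -> y \notin S -> e x y -> kitable.
    move=> xS yS xy; case: (step x xS) => [//|[_ /(_ y xy)]].
    by rewrite (negPf yS).
  have [wS|wS] := boolP (w \in S); first by apply: (adjS w u); rewrite // sym.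
  have [aS a'S c'S] : [/\ a \in S, a' \in S & c' \in S].
    by rewrite !inE !eqxx !orbT.
  have [au|au] := boolP (e a u); first exact: adjS aS uS au.
  have [a'w|a'w] := boolP (e a' w); first exact: adjS a'S wS a'w.
  have [c'u|c'u] := boolP (e c' u); first exact: adjS c'S uS c'u.
  move: P uS wS; rewrite /prism /= !inE !negb_or => P uS wS; split_and.
  have [ab'|ab'] := boolP (e a b').
    by apply: (diamond_kitable Re (p := a) (q := b) (r := c) (s := b')); graph.
  (* The first switch joins [a] to the outside vertex [u]; the second trades this edge for one from
     [a] to [b'], which closes a diamond. *)
  have Re1 : realizes (switch e a a' u w) by do_switch a a' u w.
  have Re2 : realizes (switch (switch e a a' u w) a u b' c').
    by do_switch a u b' c'.
  by apply: (diamond_kitable Re2 (p := a) (q := b) (r := c) (s := b')); graph.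
have [/existsP[x dx]|/existsPn dg3] := boolP [exists x, dg x != 3].
  by case: (step x (negbNE (allS x))) => [//|[d3 _]]; rewrite d3 in dx.
case: not_cubic6; split=> [|x]; last exact/eqP/(negbNE (dg3 x)).
case/and4P: P => _ _ _ /card_uniqP/= <-; apply: eq_card => x.
by rewrite [RHS](negbNE (allS x)).
Qed.

(** * From a star to a diamond or a prism *)

(** Switching [v3 w] and [v4 z] would join [v3] to [v4], so [z] and [w] may be taken adjacent. Then
    either [v4 w] completes a prism on the triangles [v1 v2 v3] and [v4 z w], or [v1 v4] and [z w]
    can be switched. *)
Lemma paw_shared_kitable e v1 v2 v3 v4 z w : realizes e ->
    [&& e v1 v2, e v1 v3, e v1 v4 & e v2 v3] ->
    [&& ~~ e v2 v4, ~~ e v3 v4, v2 != v4 & v3 != v4] ->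
    [&& e v4 z, e v2 z, ~~ e v3 z & z != v1] ->
    [&& e v3 w, w != v1 & w != v2] ->
  kitable.
Proof.
move=> Re /and4P[v12 v13 v14 v23] /and4P[v24 v34 n24 n34].
move=> /and4P[v4z v2z v3z z1] /and3P[v3w w1 w2].
have [sym irr _] := Re.
have [v2w|v2w] := boolP (e v2 w).
  by apply: (diamond_kitable Re (p := v2) (q := v3) (r := v1) (s := w)); graph.
have [zw|zw] := boolP (e z w); last first.
  have Re' : realizes (switch e v3 w v4 z) by do_switch v3 w v4 z.
  by apply: (diamond_kitable Re' (p := v1) (q := v3) (r := v2) (s := v4));
    graph.
have [v1z|v1z] := boolP (e v1 z).
  by apply: (diamond_kitable Re (p := v1) (q := v2) (r := v3) (s := z)); graph.
have [v4w|v4w] := boolP (e v4 w).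
  by apply: (prism_kitable (a := v1) (b := v2) (c := v3) (a' := v4) (b' := z)
    (c' := w) Re); graph.
have Re' : realizes (switch e v1 v4 z w) by do_switch v1 v4 z w.
by apply: (diamond_kitable Re' (p := v1) (q := v2) (r := v3) (s := z)); graph.
Qed.

(** A neighbour [z] of [v4] adjacent to both [v2] and [v3] gives a diamond, and one adjacent to just
    one of them is the shared case. Otherwise an edge at [v2] or [v3] is switched with [v4 z],
    unless its other end is adjacent to [z]. *)
Lemma paw_high_kitable e v1 v2 v3 v4 : realizes e ->
    [&& e v1 v2, e v1 v3 & e v1 v4] -> e v2 v3 ->
    [&& ~~ e v2 v4, ~~ e v3 v4, v2 != v4 & v3 != v4] ->
    [&& 2 < dg v2, 2 < dg v3 & 1 < dg v4] ->
  kitable.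
Proof.
move=> Re /and3P[v12 v13 v14] v23 /and4P[v24 v34 n24 n34] /and3P[d2 d3 d4].
have [sym irr _] := Re.
have [z v4z] := @nbr_notin e v4 [:: v1] Re d4.
rewrite !inE => z1.
have [w v2w] := @nbr_notin e v2 [:: v1; v3] Re d2.
have [w' v3w] := @nbr_notin e v3 [:: v1; v2] Re d3.
rewrite !inE !negb_or => /andP[w'1 w'2] /andP[w1 w3].
have [v2z|v2z] := boolP (e v2 z); have [v3z|v3z] := boolP (e v3 z).
- by apply: (diamond_kitable Re (p := v2) (q := v3) (r := v1) (s := z)); graph.
- by apply: (paw_shared_kitable (v1 := v1) (v2 := v2) (v3 := v3) (v4 := v4)
  (z := z) (w := w') Re); graph.
- by apply: (paw_shared_kitable (v1 := v1) (v2 := v3) (v3 := v2) (v4 := v4)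
  (z := z) (w := w) Re); graph.
have [wv3|wv3] := boolP (e w v3).
  by apply: (diamond_kitable Re (p := v2) (q := v3) (r := v1) (s := w)); graph.
have [wv2|wv2] := boolP (e w' v2).
  by apply: (diamond_kitable Re (p := v2) (q := v3) (r := v1) (s := w')); graph.
have [wz|wz] := boolP (e w z); last first.
  have Re' : realizes (switch e v2 w v4 z) by do_switch v2 w v4 z.
  by apply: (diamond_kitable Re' (p := v1) (q := v2) (r := v3) (s := v4));
    graph.
have [wz'|wz'] := boolP (e w' z); last first.
  have Re' : realizes (switch e v3 w' v4 z) by do_switch v3 w' v4 z.
  by apply: (diamond_kitable Re' (p := v1) (q := v3) (r := v2) (s := v4));
    graph.
(* If [z], [w], [w'] form a triangle, joining [v3] to [z] puts a second triangle on the edge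
   [z w']. *)
have [ww|ww] := boolP (e w w').
  have Re' : realizes (switch e v4 z v2 v3) by do_switch v4 z v2 v3.
  by apply: (diamond_kitable Re' (p := z) (q := w') (r := w) (s := v3)); graph.
(* This deletes the edge [z w], which alone blocks the switch of [v2 w] and [v4 z]. *)
have Re1 : realizes (switch e v3 w' z w) by do_switch v3 w' z w.
have Re2 : realizes (switch (switch e v3 w' z w) v2 w v4 z).
  by do_switch v2 w v4 z.
by apply: (diamond_kitable Re2 (p := v1) (q := v2) (r := v3) (s := v4)); graph.
Qed.

(** Now [v3] is the pendant vertex of the paw. By [link], distinct neighbours of [v2] and [v3]
    outside the paw may be taken adjacent; the proof splits on whether [v2] and [v3] share a
    neighbour besides [v1]. *)
Lemma paw_low_kitable e v1 v2 v3 v4 : realizes e ->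
    [&& e v1 v2, e v1 v3 & e v1 v4] -> e v2 v4 ->
    [&& ~~ e v2 v3, ~~ e v3 v4, v2 != v3 & v3 != v4] ->
    2 < dg v2 -> 2 < dg v3 ->
  kitable.
Proof.
move=> Re /and3P[v12 v13 v14] v24 /and4P[v23 v34 n23 n34] d2 d3.
have [sym irr _] := Re.
have link w z : e v2 w -> w != v1 -> w != v4 -> e v3 z -> z != v1 -> w != z ->
    ~~ e w z -> kitable.
  move=> v2w w1 w4 v3z z1 nwz wz.
  have Re' : realizes (switch e v2 w v3 z) by do_switch v2 w v3 z.
  by apply: (diamond_kitable Re' (p := v1) (q := v2) (r := v3) (s := v4));
    graph.
have [/existsP[z /and3P[v2z v3z z1]]|/existsPn disj] :=
    boolP [exists z, [&& e v2 z, e v3 z & z != v1]].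
  have [z' v3z'] := @nbr_notin e v3 [:: v1; z] Re d3.
  rewrite !inE negb_or => /andP[z'1 nz].
  have z4 : z != v4 by neq.
  have [zz|zz] := boolP (e z z'); last first.
    by apply: (link z z'); rewrite // eq_sym.
  have [v2z'|v2z'] := boolP (e v2 z').
    by apply: (diamond_kitable Re (p := z) (q := z') (r := v2) (s := v3));
      graph.
  (* The triangles [v1 v2 v4] and [v3 z z'] are joined by [v1 v3] and [v2 z], so only the edge
     [v4 z'] can be missing from a prism. *)
  have [v4z'|v4z'] := boolP (e v4 z').
    by apply: (prism_kitable (a := v1) (b := v2) (c := v4) (a' := v3) (b' := z)
      (c' := z') Re); graph.
  have Re' : realizes (switch e v2 v4 v3 z') by do_switch v2 v4 v3 z'.
  by apply: (diamond_kitable Re' (p := v2) (q := v3) (r := v1) (s := z)); graph.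
have [w v2w] := @nbr_notin e v2 [:: v1; v4] Re d2.
have [z v3z] := @nbr_notin e v3 [:: v1] Re (ltnW d3).
have [z' v3z'] := @nbr_notin e v3 [:: v1; z] Re d3.
rewrite !inE !negb_or => /andP[z'1 nz] z1 /andP[w1 w4].
have v2z : ~~ e v2 z by have := disj z; rewrite v3z z1 !andbT.
have v2z' : ~~ e v2 z' by have := disj z'; rewrite v3z' z'1 !andbT.
have v3w : ~~ e v3 w by have := disj w; rewrite v2w w1 !andbT.
have nwz : w != z by neq.
have nwz' : w != z' by neq.
have [wz|wz] := boolP (e w z); last exact: (link w z).
have [wz'|wz'] := boolP (e w z'); last exact: (link w z').
have [zz|zz] := boolP (e z z').
  by apply: (diamond_kitable Re (p := z) (q := z') (r := w) (s := v3)); graph.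
have [v4w|v4w] := boolP (e v4 w).
  by apply: (diamond_kitable Re (p := v2) (q := v4) (r := v1) (s := w)); graph.
have v4_low x y : e v3 x -> e v3 y -> x != v1 -> y != v1 -> x != y ->
    ~~ e x y -> e v4 y -> kitable.
  move=> v3x v3y x1 y1 nxy xy v4y.
  have Re' : realizes (switch e v3 x v4 y) by do_switch v3 x v4 y.
  by apply: (diamond_kitable Re' (p := v1) (q := v4) (r := v2) (s := v3));
    graph.
have [v4z|v4z] := boolP (e v4 z); first by apply: (v4_low z' z); rewrite // sym.
have [v4z'|v4z'] := boolP (e v4 z').
  by apply: (v4_low z z'); rewrite // eq_sym.
(* The first switch makes [x] a common neighbour of [v1] and [v3], giving up [v1 v4]; the second
   joins [v2] to [v3], so that [v1] and [v3] become the centres. *)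
have two_steps x y : e v3 x -> e v3 y -> x != y -> ~~ e x y -> e w x ->
    ~~ e v4 y -> ~~ e v2 x -> x != v1 -> y != v1 -> ~~ e v1 x -> kitable.
  move=> v3x v3y nxy xy wx v4y v2x x1 y1 v1x.
  have Re1 : realizes (switch e v1 v4 x w) by do_switch v1 v4 x w.
  have Re2 : realizes (switch (switch e v1 v4 x w) v2 v4 v3 y).
    by do_switch v2 v4 v3 y.
  by apply: (diamond_kitable Re2 (p := v1) (q := v3) (r := v2) (s := x)); graph.
have [v1z|v1z] := boolP (e v1 z); last first.
  by apply: (two_steps z z'); rewrite // eq_sym.
have [v1z'|v1z'] := boolP (e v1 z'); last first.
  by apply: (two_steps z' z); rewrite // sym.
by apply: (diamond_kitable Re (p := v1) (q := v3) (r := z) (s := z')); graph.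
Qed.

(** A switch joining [v2] to [v3] leads to the paw of [paw_high_kitable]. If all such switches are
    blocked, the neighbours of [v2] and those of [v3] are adjacent to each other. *)
Lemma claw_kitable e v1 v2 v3 v4 : realizes e ->
    [&& e v1 v2, e v1 v3 & e v1 v4] ->
    [&& ~~ e v2 v3, ~~ e v2 v4 & ~~ e v3 v4] ->
    [&& v2 != v3, v2 != v4 & v3 != v4] ->
    [&& 2 < dg v2, 2 < dg v3 & 1 < dg v4] ->
  kitable.
Proof.
move=> Re /and3P[v12 v13 v14] /and3P[v23 v24 v34] /and3P[n23 n24 n34] degs.
have [sym irr _] := Re; have /and3P[d2 d3 _] := degs.
have link w z : e v2 w -> w != v1 -> e v3 z -> z != v1 -> w != z ->
    ~~ e w z -> kitable.
  move=> v2w w1 v3z z1 nwz wz.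
  have Re' : realizes (switch e v2 w v3 z) by do_switch v2 w v3 z.
  by apply: (paw_high_kitable Re' (v1 := v1) (v2 := v2) (v3 := v3) (v4 := v4));
    graph.
have [/existsP[c /and3P[v2c v3c c1]]|/existsPn disj] :=
    boolP [exists c, [&& e v2 c, e v3 c & c != v1]].
  have [w v2w] := @nbr_notin e v2 [:: v1; c] Re d2.
  have [z v3z] := @nbr_notin e v3 [:: v1; c] Re d3.
  rewrite !inE !negb_or => /andP[z1 zc] /andP[w1 wc].
  have [ewc|ewc] := boolP (e w c); last exact: (link w c).
  have [ecz|ecz] := boolP (e c z); last by apply: (link c z); rewrite // eq_sym.
  have [v3w|v3w] := boolP (e v3 w).
    by apply: (diamond_kitable Re (p := c) (q := w) (r := v2) (s := v3)); graph.
  have nwz : w != z by neq.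
  have [wz|wz] := boolP (e w z); last exact: (link w z).
  by apply: (diamond_kitable Re (p := c) (q := w) (r := v2) (s := z)); graph.
have [w v2w] := @nbr_notin e v2 [:: v1] Re (ltnW d2).
have [w' v2w'] := @nbr_notin e v2 [:: v1; w] Re d2.
have [z v3z] := @nbr_notin e v3 [:: v1] Re (ltnW d3).
have [z' v3z'] := @nbr_notin e v3 [:: v1; z] Re d3.
rewrite !inE !negb_or => /andP[z'1 nz] z1 /andP[w'1 nw] w1.
have v2z : ~~ e v2 z by have := disj z; rewrite v3z z1 !andbT.
have v2z' : ~~ e v2 z' by have := disj z'; rewrite v3z' z'1 !andbT.
have v3w : ~~ e v3 w by have := disj w; rewrite v2w w1 !andbT.
have v3w' : ~~ e v3 w' by have := disj w'; rewrite v2w' w'1 !andbT.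
have [wz|wz] := boolP (e w z); last by apply: (link w z) => //; neq.
have [wz'|wz'] := boolP (e w z'); last by apply: (link w z') => //; neq.
have [w'z|w'z] := boolP (e w' z); last by apply: (link w' z) => //; neq.
have [w'z'|w'z'] := boolP (e w' z'); last by apply: (link w' z') => //; neq.
have [ww|ww] := boolP (e w w').
  by apply: (diamond_kitable Re (p := w) (q := w') (r := v2) (s := z)); graph.
(* The vertices [w], [z], [w'], [z'] form a 4-cycle, which both switches preserve; together they add
   its chord [w w']. *)
have Re1 : realizes (switch e v2 w z v3) by do_switch v2 w z v3.
have Re2 : realizes (switch (switch e v2 w z v3) v2 w' v3 w).
  by do_switch v2 w' v3 w.
by apply: (diamond_kitable Re2 (p := w) (q := w') (r := z) (s := z')); graph.
Qed.

(** Two edges among the leaves close a diamond, one gives a paw, none a claw. The position of a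
    single edge matters since [v4] is only known to have degree at least 2. *)
Lemma star_kitable e v1 v2 v3 v4 : realizes e ->
    [&& e v1 v2, e v1 v3 & e v1 v4] ->
    [&& v2 != v3, v2 != v4 & v3 != v4] ->
    [&& 2 < dg v2, 2 < dg v3 & 1 < dg v4] ->
  kitable.
Proof.
move=> Re star neqs degs; have [sym irr _] := Re.
have /and3P[v12 v13 v14] := star; have /and3P[n23 n24 n34] := neqs.
have /and3P[d2 d3 d4] := degs.
have [v23|v23] := boolP (e v2 v3); have [v24|v24] := boolP (e v2 v4);
  have [v34|v34] := boolP (e v3 v4).
1,2: by apply: (diamond_kitable Re (p := v1) (q := v2) (r := v3) (s := v4));
  graph.
- by apply: (diamond_kitable Re (p := v1) (q := v3) (r := v2) (s := v4)); graph.
- by apply: (paw_high_kitable Re (v1 := v1) (v2 := v2) (v3 := v3) (v4 := v4));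
  graph.
- by apply: (diamond_kitable Re (p := v1) (q := v4) (r := v2) (s := v3)); graph.
- by apply: (paw_low_kitable Re (v1 := v1) (v2 := v2) (v3 := v3) (v4 := v4));
  graph.
- by apply: (paw_low_kitable Re (v1 := v1) (v2 := v3) (v3 := v2) (v4 := v4));
  graph.
by apply: (claw_kitable Re (v1 := v1) (v2 := v2) (v3 := v3) (v4 := v4)); graph.
Qed.

End Potential.
End Switch.

(** * From relations on the vertices back to graphs *)

Lemma adj_realizes (G : sgraph) : realizes (@degree G) (@adj G).
Proof. by split; [exact: adj_sym | exact: adj_irr |]. Qed.

Lemma kitable_potentially_graphic (G : sgraph) : kitable (@degree G) ->
  potentially_graphic K5_minus_Y4 (degree_sequence G).
Proof.
move=> [e [p [q [r [s [t [[sym irr deg] /and5P[pq pr qr ps]]]]]]]].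
move=> /and4P[qs rt nrs]; rewrite !inE !negb_or => /and3P[ntp ntq nts].
exists (SGraph sym irr); first by congr (sort _ _); apply: eq_map.
(* The order follows the labels of [K5_minus_Y4]: 0 is the pendant vertex, attached to 4; 1 and 2
   are the centres; 3 and 4 are the ends. *)
have Us : uniq [:: t; p; q; s; r].
  rewrite /= !inE !negb_or ntp ntq nts (eq_sym t) (adj_neq irr rt).
  rewrite (adj_neq irr pq) (adj_neq irr ps) (adj_neq irr pr).
  by rewrite (adj_neq irr qs) (adj_neq irr qr) eq_sym nrs.
exists (fun i : 'I_5 => nth t [:: t; p; q; s; r] i).
  by move=> i j /eqP; rewrite nth_uniq ?ltn_ord // => /eqP; apply: val_inj.
by case=> [[|[|[|[|[|i]]]]] Hi] //; case=> [[|[|[|[|[|j]]]]] Hj] // _;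
  rewrite /= // sym.
Qed.

(** * Necessity of the degree conditions *)

Lemma degree_K5_minus_Y4 (i : K5_minus_Y4) :
  degree i = nth 0 [:: 1; 3; 3; 2; 3] (i : 'I_5).
Proof.
rewrite /degree -sum1dep_card big_mkcond !big_ord_recl big_ord0.
by case: i => [[|[|[|[|[|i]]]]] Hi].
Qed.

Lemma leq_nth_count (p : seq nat) m k : sorted geq p ->
  k < count (leq m) p -> m <= nth 0 p k.
Proof.
have geq_trans : transitive geq by move=> a b c ba ac; apply: leq_trans ac ba.
elim: p k => [|d p IHp] [|k] //= pth; last first.
  move=> ltk; apply: IHp (path_sorted pth) _; rewrite -ltnS.
  by apply: leq_trans ltk _; rewrite -add1n leq_add2r leq_b1.
case: (leqP m d) => // ltdm; rewrite add0n -has_count => /hasP[c pc lemc].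
have : c <= d := allP (order_path_min geq_trans pth) c pc.
by rewrite leqNgt (leq_trans ltdm lemc).
Qed.

Lemma leq_nth_degree_sequence (G : sgraph) m k :
  k < #|[set x : G | m <= degree x]| -> m <= nth 0 (degree_sequence G) k.
Proof.
move=> ltk; apply: leq_nth_count.
  by apply: sort_sorted => a b; apply: leq_total.
by rewrite count_sort count_map -sum1_count big_enum_cond sum1dep_card.
Qed.

Lemma leq_degree_subgraph (G H : sgraph) (f : H -> G) i :
  injective f -> {homo f : x y / adj x y} -> degree i <= degree (f i).
Proof.
move=> f_inj f_homo; rewrite /degree -(card_imset _ f_inj).
apply/subset_leq_card/subsetP=> _ /imsetP[j ij ->].
by move: ij; rewrite !inE; apply: f_homo.
Qed.

Lemma leq_card_degree_subgraph (G H : sgraph) m : has_subgraph G H ->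
  #|[set i : H | m <= degree i]| <= #|[set x : G | m <= degree x]|.
Proof.
move=> [f f_inj f_homo]; rewrite -(card_imset _ f_inj).
apply/subset_leq_card/subsetP=> _ /imsetP[i im ->]; move: im; rewrite !inE.
move=> im; exact: leq_trans im (leq_degree_subgraph i f_inj f_homo).
Qed.

(** The only vertex [x] outside the kite has its three neighbours inside it, and one of them already
    has degree 3 within the kite, which leaves no room for [x]. *)
Lemma cubic6_no_kite (G : sgraph) : #|G| = 6 -> (forall x : G, degree x = 3) ->
  ~ has_subgraph G K5_minus_Y4.
Proof.
move=> G6 G3 [f f_inj f_homo].
pose c := codom f; have sz_c : size c = 5 by rewrite size_codom card_ord.
have Uc : uniq c by apply/injectiveP.
have [x _ xc] : exists2 x, x \in [set: G] & x \notin c.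
  by apply: exists_notin; rewrite sz_c cardsT G6.
(* Labels 0 and 3 are the only vertices of the kite with degree below 3. *)
pose o : 'I_5 := @Ordinal 5 0 isT; pose o3 : 'I_5 := @Ordinal 5 3 isT.
have [y xy yN] : exists2 y, adj x y & y \notin [:: f o; f o3].
  by apply: nbr_notin (adj_realizes G) _; rewrite G3.
have /codomP[i yE] : y \in c.
  apply: contraT => yc; have Uxy : uniq [:: x, y & c].
    by rewrite /= inE negb_or xc yc Uc !andbT; apply: adj_neq (@adj_irr G) xy.
  by have := max_card [in [:: x, y & c]]; rewrite (card_uniqP Uxy) /= sz_c G6.
have degi : degree i = 3.
  rewrite degree_K5_minus_Y4; move: yN; rewrite yE !inE !(inj_eq f_inj).
  by case: (i) => [[|[|[|[|[|j]]]]] Hj].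
have : x \in f @: [set j | adj i j].
  have -> : f @: [set j | adj i j] = [set z | adj (f i) z].
    apply/eqP; rewrite eqEcard card_imset // -![#|[set _ | _]|]/(degree _).
    rewrite G3 degi leqnn andbT; apply/subsetP=> _ /imsetP[j ij ->].
    by move: ij; rewrite !inE; apply: f_homo.
  by rewrite inE -yE adj_sym.
by case/imsetP=> j _ xE; case/negP: xc; rewrite xE codom_f.
Qed.

Theorem theorem2p2 (n : nat) (pi : n.-tuple nat) (n_ge5 : 5 <= n)
    (pi_graphic : graphic pi) (pi_sorted : sorted geq pi)
    (pi_ge1 : 1 <= nth 0 pi n.-1) :
  potentially_graphic K5_minus_Y4 pi <->
    [/\ 3 <= nth 0 pi 2, 2 <= nth 0 pi 3 & tval pi <> nseq 6 3].
Proof.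
split=> [[G <- kG]|[pi2 pi3 pi_not]].
  have big m k : k < #|[set i : K5_minus_Y4 | m <= degree i]| ->
      m <= nth 0 (degree_sequence G) k.
    move=> ltk; apply: leq_nth_degree_sequence.
    exact: leq_trans ltk (leq_card_degree_subgraph m kG).
  (* The kite has three vertices of degree at least 3 and four of degree at least 2; counting from
     0, this concerns the indices 2 and 3. *)
  split; [apply: big | apply: big |].
  - rewrite -sum1dep_card big_mkcond.
    under eq_bigr do rewrite degree_K5_minus_Y4.
    by rewrite !big_ord_recl big_ord0.
  - rewrite -sum1dep_card big_mkcond.
    under eq_bigr do rewrite degree_K5_minus_Y4.
    by rewrite !big_ord_recl big_ord0.
  move=> G6; have all3 : all (pred1 3) (degree_sequence G) by rewrite G6.
  apply: (cubic6_no_kite _ _ kG).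
    by rewrite cardE -(size_map (@degree G)) -(size_sort geq)
      -/(degree_sequence G) G6.
  move=> x; apply/eqP; apply: (allP all3).
  by rewrite mem_sort map_f ?mem_enum.
have [G defpi] := pi_graphic.
(* Sorting the vertices themselves attaches a vertex to each term of [pi]. *)
pose s := sort (relpre (@degree G) geq) (enum G).
have pi_s : map (@degree G) s = pi by rewrite -defpi /degree_sequence sort_map.
have Us : uniq s by rewrite sort_uniq enum_uniq.
have in_s x : x \in s by rewrite mem_sort mem_enum.
have sz_s : size s = n by rewrite -(size_map (@degree G)) pi_s size_tuple.
have cardG : #|G| = n by rewrite cardE -(size_sort (relpre (@degree G) geq)).
have geq_trans : transitive (relpre (@degree G) geq).
  by move=> a b c ba ac; apply: leq_trans ac ba.
have s_sorted : sorted (relpre (@degree G) geq) s.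
  by apply: sort_sorted => a b; apply: leq_total.
rewrite -defpi; apply: kitable_potentially_graphic.
rewrite -pi_s in pi2 pi3 pi_ge1.
have n_gt0 : 0 < n by apply: leq_trans n_ge5.
have deg_gt0 (x : G) : 0 < degree x.
  apply: leq_trans pi_ge1 _; rewrite (nth_map x) ?sz_s ?ltn_predL //.
  rewrite -{2}(nth_index x (in_s x)).
  apply: (sorted_leq_nth geq_trans _ x s_sorted); rewrite ?inE ?index_mem ?sz_s
    ?ltn_predL //=.
    by move=> y; apply: leqnn.
  by rewrite -ltnS prednK // -sz_s index_mem.
have not_cubic : ~ (#|G| = 6 /\ forall x : G, degree x = 3).
  move=> [G6 G3]; apply: pi_not; rewrite -pi_s -[6]G6 cardG -sz_s
    -(size_map (@degree G)).
  by apply/all_pred1P/allP=> _ /mapP[x _ ->]; rewrite /= G3.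
case: s => [|v1 [|v2 [|v3 [|v4 s]]]] in pi_s Us in_s sz_s s_sorted pi2 pi3
  pi_ge1 *; try by rewrite -sz_s in n_ge5.
rewrite /= in pi2 pi3; have /and4P[d12 d23 d34 _] := s_sorted.
have d2 : 2 < degree v2 by apply: leq_trans pi2 d23.
have d1 : 2 < degree v1 by apply: leq_trans d2 d12.
(* The bound [d1] leaves room at [v1] for three prescribed neighbours. *)
have [e Re star] := realizes_star (s := [:: v2; v3; v4]) (adj_realizes G) Us
  in_s (path_sorted s_sorted) d1.
have /and4P[] := Us; rewrite !inE !negb_or.
move=> /and4P[n12 n13 _ _] /and3P[n23 n24 _] /andP[n34 _] _.
apply: (star_kitable _ deg_gt0 _ not_cubic Re (v1 := v1) (v2 := v2) (v3 := v3)
  (v4 := v4)).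
- by rewrite cardG.
- have U3 : uniq [:: v1; v2; v3] by rewrite /= !inE negb_or n12 n13 n23.
  have card3 : 2 < #|[:: v1; v2; v3]| by rewrite (card_uniqP U3).
  apply: leq_trans card3 _; apply/subset_leq_card/subsetP=> x; rewrite !inE.
  by case/or3P=> /eqP->.
- by rewrite !star // !inE eqxx ?orbT.
- by rewrite n23 n24 n34.
by rewrite d2 pi2 pi3.
Qed.
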